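(* Let $a,b,c,p,q,r\in\mathbb{R}$ and let $\mu\in\mathbb{R}$ with $\mu\neq 0$. Consider the planar system $$\dot x=\mu x+ax^2+bxy+cy^2,\qquad \dot y=\mu y+px^2+qxy+ry^2 .$$ Define $$P=27c^2p^2-18cp(b-r)(q-a)-4p(b-r)^3-4c(q-a)^3-(q-a)^2(b-r)^2,$$ $$R=(ar-pc)^2+(cq-br)(aq-bp),$$ $$I=aq+br-bp-cq .$$ Then: (a) If $P>0$ and $R>0$, the system has exactly one non-zero fixed point, and it is a saddle point. (b) If $P>0$ and $R<0$, the system has exactly one non-zero fixed point, and it is a node. (c) If $P<0$ and $R>0$, the system has exactly three non-zero fixed points, one of which is a node and two of which are saddle points. (d) If $P<0$, $R<0$ and $I>0$, the system has exactly three non-zero fixed points, two of which are nodes and one of which is a saddle point. (e) If $P<0$, $R<0$ and $I<0$, the system has exactly three non-zero fixed points, all of which are saddle points.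
   Context: A non-zero fixed point is a point $(x,y)\in\mathbb{R}^2\setminus\{(0,0)\}$ at which both right-hand sides vanish. A fixed point is a saddle point if the Jacobian matrix of the right-hand side there has two non-zero real eigenvalues of opposite sign, and a node (stable or unstable) if the Jacobian matrix there has two non-zero real eigenvalues of the same sign. *)

(* Defs.v *)
From HB Require Import structures.
From mathcomp Require Import all_boot all_order all_algebra.
From mathcomp Require Import all_classical all_reals all_analysis.

Set Implicit Arguments.
Unset Strict Implicit.
Unset Printing Implicit Defensive.

Import Order.TTheory GRing.Theory Num.Theory.
Import numFieldNormedType.Exports.

Local Open Scope classical_set_scope.
Local Open Scope ring_scope.

(* A point (x, y) of the plane is the row vector v with x = v 0 0 and
   y = v 0 1. *)
Definition quadratic_field (R : realType) (mu a b c p q r : R)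
    (v : 'rV[R]_2) : 'rV[R]_2 :=
  let x := v 0 0 in
  let y := v 0 1 in
  \row_(j < 2) [:: mu * x + a * x ^+ 2 + b * x * y + c * y ^+ 2;
                   mu * y + p * x ^+ 2 + q * x * y + r * y ^+ 2]`_j.

Definition nonzero_fixed_points (R : realType) (f : 'rV[R]_2 -> 'rV[R]_2) :
    set 'rV[R]_2 :=
  [set v | v != 0 /\ f v = 0].

(* l1 and l2 are the two eigenvalues of A counted with algebraic multiplicity:
   a node may have a double eigenvalue, possibly with a one-dimensional
   eigenspace. *)
Definition eigenvalue_pair (R : realType) (A : 'M[R]_2) (l1 l2 : R) : Prop :=
  char_poly A = ('X - l1%:P) * ('X - l2%:P).

(* 'J f v acts on row vectors, so it is the transpose of the matrix of partial
   derivatives written with one row per component of f; the two matrices have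
   the same characteristic polynomial. *)
Definition saddle_point (R : realType) (f : 'rV[R]_2 -> 'rV[R]_2)
    (v : 'rV[R]_2) : Prop :=
  f v = 0 /\
  exists l1 l2 : R, eigenvalue_pair ('J f v) l1 l2 /\ l1 < 0 /\ 0 < l2.

Definition node (R : realType) (f : 'rV[R]_2 -> 'rV[R]_2)
    (v : 'rV[R]_2) : Prop :=
  f v = 0 /\
  exists l1 l2 : R, eigenvalue_pair ('J f v) l1 l2 /\
    ((l1 < 0 /\ l2 < 0) \/ (0 < l1 /\ 0 < l2)).

Definition P_of (R : realType) (a b c p q r : R) : R :=
  27 * c ^+ 2 * p ^+ 2 - 18 * c * p * (b - r) * (q - a)
  - 4 * p * (b - r) ^+ 3 - 4 * c * (q - a) ^+ 3
  - (q - a) ^+ 2 * (b - r) ^+ 2.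

Definition R_of (R : realType) (a b c p q r : R) : R :=
  (a * r - p * c) ^+ 2 + (c * q - b * r) * (a * q - b * p).

Definition I_of (R : realType) (a b c p q r : R) : R :=
  a * q + b * r - b * p - c * q.

Definition fixed_point_count (R : realType) (f : 'rV[R]_2 -> 'rV[R]_2)
    (total nodes saddles : nat) : Prop :=
  [/\ (nonzero_fixed_points f #= `I_total)%card,
      (nonzero_fixed_points f `&` [set v | node f v] #= `I_nodes)%card &
      (nonzero_fixed_points f `&` [set v | saddle_point f v]
         #= `I_saddles)%card].

(* Main.v *)
Require Import Defs.
From HB Require Import structures.
From mathcomp Require Import all_boot all_order all_algebra.
From mathcomp Require Import all_classical all_reals all_analysis.
From mathcomp Require Import ring lra.
From mathcomp Require polyrcf.

Set Implicit Arguments.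
Unset Strict Implicit.
Unset Printing Implicit Defensive.

Import Order.TTheory GRing.Theory Num.Theory.
Import numFieldNormedType.Exports.

Local Open Scope classical_set_scope.
Local Open Scope ring_scope.

(* Let (A, B) be the quadratic part and C = y A - x B. The non-zero fixed points
   are the points -(mu / lam) X, one for each real line C(X) = 0, where
   (A, B)(X) = lam X; lam <> 0 because R is the resultant of A and B. The
   discriminant of C is -P, so there is one such line if P > 0 and three if
   P < 0. At the fixed point the eigenvalues are -mu (along X) and mu D / lam,
   where D is the derivative of C across the line, so the type is read off the
   sign of s = lam / D. If P > 0, then R s > 0. If P < 0, the three values
   satisfy s1 + s2 + s3 = 1 and R s1 s2 s3 < 0. Finally, half the Jacobian
   determinant of (A, B) is a quadratic form with trace I, definite when R < 0,
   and with value D^2 s (s - 1) at X; hence for R < 0 the sign of s (s - 1) is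
   that of I. *)

(** * Cardinalities of finite sets of fixed points *)

Lemma card_eq_uniq_seq (T : choiceType) (s : seq T) :
  uniq s -> ([set` s] #= `I_(size s))%card.
Proof.
elim: s => [_|x s IH /= /andP[xs us]].
  by rewrite II0 card_eq0; apply/eqP/seteqP; split.
apply/eq_cardSP; exists x; first by rewrite /= mem_head.
suff -> : [set` x :: s] `\ x = [set` s] by exact: IH.
apply/seteqP; split => y /=; rewrite in_cons.
  by case=> /orP[/eqP|].
by move=> ys; split; [rewrite ys orbT | move=> yx; rewrite -yx ys in xs].
Qed.

Lemma fixed_point_count_seq (R : realType) (f : 'rV[R]_2 -> 'rV[R]_2)
    (s : seq 'rV[R]_2) :
  uniq s -> nonzero_fixed_points f = [set` s] ->
  fixed_point_count f (size s) (count (fun v => `[< node f v >]) s)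
    (count (fun v => `[< saddle_point f v >]) s).
Proof.
move=> us fs.
have sub (Q : 'rV[R]_2 -> Prop) :
    (nonzero_fixed_points f `&` [set v | Q v]
       #= `I_(count (fun v => `[< Q v >]) s))%card.
  rewrite -size_filter.
  suff -> : nonzero_fixed_points f `&` [set v | Q v] =
      [set` [seq v <- s | `[< Q v >]]].
    exact/card_eq_uniq_seq/filter_uniq.
  rewrite fs; apply/seteqP; split => v /=; rewrite mem_filter.
    by case=> -> /asboolP ->.
  by move=> /andP[/asboolP].
by split; [rewrite fs; exact: card_eq_uniq_seq | exact: sub | exact: sub].
Qed.

(** * Eigenvalues of 2 by 2 matrices and the type of a fixed point *)

Lemma det_mx22 (R : comNzRingType) (A : 'M[R]_2) :
  \det A = A 0 0 * A 1 1 - A 0 1 * A 1 0.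
Proof.
rewrite (expand_det_row _ 0) !big_ord_recl big_ord0 /cofactor !det_mx11 !mxE /=.
rewrite addr0 expr0 mul1r expr1 mulN1r mulrN.
by congr (_ * A _ _ - A _ _ * A _ _); apply/val_inj.
Qed.

Lemma char_poly_mx22 (R : comNzRingType) (A : 'M[R]_2) (l1 l2 : R) :
  A 0 0 + A 1 1 = l1 + l2 -> A 0 0 * A 1 1 - A 0 1 * A 1 0 = l1 * l2 ->
  char_poly A = ('X - l1%:P) * ('X - l2%:P).
Proof.
move=> tr dt; rewrite /char_poly det_mx22 !mxE /=.
rewrite !mulr0n !mulr1n !sub0r.
have -> : ('X - l1%:P) * ('X - l2%:P) = 'X * 'X - (l1 + l2)%:P * 'X
    + (l1 * l2)%:P by rewrite polyCD polyCM; ring.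
rewrite -tr -dt polyCB !polyCM polyCD; ring.
Qed.

(** The product does not depend on the pair chosen, so one known pair of eigenvalues at a fixed
    point decides whether it is a saddle or a node. *)
Lemma eigenvalue_pair_mul (R : realType) (A : 'M[R]_2) (l1 l2 : R) :
  eigenvalue_pair A l1 l2 -> l1 * l2 = \det A.
Proof.
move=> /(congr1 (fun P : {poly R} => P`_0)).
rewrite char_poly_det sqrrN expr1n mul1r => ->.
by rewrite -horner_coef0 !hornerE mulrNN.
Qed.

Lemma saddle_pointE (R : realType) (f : 'rV[R]_2 -> 'rV[R]_2) (v : 'rV[R]_2)
    (l1 l2 : R) :
  f v = 0 -> eigenvalue_pair ('J f v) l1 l2 ->
  `[< saddle_point f v >] = (l1 * l2 < 0).
Proof.
move=> fv ev; apply/asboolP/idP => [[_ [m1 [m2 [/eigenvalue_pair_mul em [m1n m2p]]]]]|].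
  by rewrite (eigenvalue_pair_mul ev) -em nmulr_rlt0.
move=> l12; split => //.
have [l1n|l1p|l10] := ltgtP l1 0.
- by exists l1, l2; rewrite -(nmulr_rlt0 _ l1n).
- by exists l2, l1; rewrite -(pmulr_rlt0 _ l1p) /eigenvalue_pair mulrC.
- by move: l12; rewrite l10 mul0r ltxx.
Qed.

Lemma nodeE (R : realType) (f : 'rV[R]_2 -> 'rV[R]_2) (v : 'rV[R]_2)
    (l1 l2 : R) :
  f v = 0 -> eigenvalue_pair ('J f v) l1 l2 ->
  `[< node f v >] = (0 < l1 * l2).
Proof.
move=> fv ev; apply/asboolP/idP => [[_ [m1 [m2 [/eigenvalue_pair_mul em mm]]]]|].
  rewrite (eigenvalue_pair_mul ev) -em.
  by case: mm => -[m1s m2s]; [rewrite nmulr_rgt0 | rewrite mulr_gt0].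
move=> l12; split => //; exists l1, l2; split => //.
have [l1n|l1p|l10] := ltgtP l1 0.
- by left; rewrite -(nmulr_rgt0 _ l1n).
- by right; rewrite -(pmulr_rgt0 _ l1p).
- by move: l12; rewrite l10 mul0r ltxx.
Qed.

(** * The Jacobian matrix of the field *)

Lemma is_diff_coord (R : realType) (v : 'rV[R]_2) (i : 'I_2) :
  is_diff v (fun w : 'rV[R]_2 => w 0 i : R) (fun w => w 0 i).
Proof.
apply: DiffDef; first exact: differentiable_coord.
have @g : {linear 'rV[R]_2 -> R}.
  by exists (fun N : 'rV[R]_2 => N 0 i); do 2![eexists]; do ?[constructor];
     rewrite ?mxE// => ? *; rewrite ?mxE//; move=> ?; rewrite !mxE.
by rewrite (_ : (fun _ => _) = g) // diff_lin //; exact/coord_continuous.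
Qed.

(** With linear coefficients [(mu, 0)] and [(0, mu)] this covers both components of the field. *)
Lemma is_diff_quadratic (R : realType) (V : normedModType R)
    (m1 m2 a b c : R) (x y dx dy : V -> R) (v : V) :
  is_diff v x dx -> is_diff v y dy ->
  is_diff v
    (fun w => m1 * x w + m2 * y w + a * x w ^+ 2 + b * x w * y w
              + c * y w ^+ 2)
    (fun h => (m1 + 2 * a * x v + b * y v) * dx h
              + (m2 + b * x v + 2 * c * y v) * dy h).
Proof.
move=> d0 d1.
have -> : (fun w => m1 * x w + m2 * y w + a * x w ^+ 2
  + b * x w * y w + c * y w ^+ 2) =
  m1 *: x + m2 *: y + a *: (x * x) + b *: (x * y) + c *: (y * y).
  by apply/funext => w; rewrite !fctE /GRing.scale /=; ring.
have dxy := is_diffM d0 d1; have dxx := is_diffM d0 d0.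
have dyy := is_diffM d1 d1.
have D := is_diffD (is_diffD (is_diffD (is_diffD (is_diffZ m1 d0)
  (is_diffZ m2 d1)) (is_diffZ a dxx)) (is_diffZ b dxy)) (is_diffZ c dyy).
apply: (is_diff_eq D); apply/funext => h; rewrite !fctE /GRing.scale /=; ring.
Qed.

Lemma jacobian_quadratic_field (R : realType) (mu a b c p q r : R)
    (v : 'rV[R]_2) :
  let x := v 0 0 in let y := v 0 1 in
  let J := 'J (quadratic_field mu a b c p q r) v in
  [/\ J 0 0 = mu + 2 * a * x + b * y, J 0 1 = 2 * p * x + q * y,
      J 1 0 = b * x + 2 * c * y & J 1 1 = mu + q * x + 2 * r * y].
Proof.
move=> x y J.
have d0 := is_diff_coord v 0; have d1 := is_diff_coord v 1.
have D1 := is_diff_quadratic mu 0 a b c d0 d1.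
have D2 := is_diff_quadratic 0 mu p q r d0 d1.
move: D1 D2; set g1 := (fun w => _); set dg1 := (fun w => _).
set g2 := (fun w => _); set dg2 := (fun w => _) => -[df1 dE1] [df2 dE2].
have fE : quadratic_field mu a b c p q r =
    (fun w => g1 w *: (delta_mx 0 0 : 'rV[R]_2))
    + (fun w => g2 w *: (delta_mx 0 1 : 'rV[R]_2)).
  apply/funext => w; apply/rowP => j; rewrite !fctE !mxE /g1 /g2 /=.
  by case: j => -[|[|//]] /= ?; ring.
have dfE h : 'd (quadratic_field mu a b c p q r) v h =
    dg1 h *: delta_mx 0 0 + dg2 h *: delta_mx 0 1.
  rewrite fE diffD; [|exact: differentiableZl..].
  rewrite -dE1 -dE2.
  have E1 := congr1 (@^~ h) (diffZl (delta_mx 0 0 : 'rV[R]_2) df1).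
  have E2 := congr1 (@^~ h) (diffZl (delta_mx 0 1 : 'rV[R]_2) df2).
  exact: (congr2 +%R E1 E2).
rewrite /J /jacobian.
split; rewrite !mxE dfE /dg1 /dg2 !mxE /= -/x -/y; ring.
Qed.

(** * Fixed points on the invariant lines of the quadratic part *)

(* A triple d stands for the vector (d.1.1, d.1.2) with the eigenvalue d.2. *)
Definition eigendirection (R : realType) (a b c p q r : R) (d : R * R * R) :=
  let: (u, v, lam) := d in
  [&& (u != 0) || (v != 0), lam != 0,
      a * u ^+ 2 + b * u * v + c * v ^+ 2 == lam * u &
      p * u ^+ 2 + q * u * v + r * v ^+ 2 == lam * v].

(* The derivative of y A - x B at (u, v) along any (w1, w2) with
   u w2 - v w1 = 1, where (A, B) is the quadratic part. *)
Definition transversal_slope (R : realType) (a b q r : R) (d : R * R * R) : R :=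
  let: (u, v, lam) := d in 3 * lam - ((2 * a + q) * u + (b + 2 * r) * v).

Definition direction_point (R : realType) (mu : R) (d : R * R * R) : 'rV[R]_2 :=
  let: (u, v, lam) := d in \row_j [:: - mu / lam * u; - mu / lam * v]`_j.

Lemma quadratic_field_eq0 (R : realType) (mu a b c p q r : R) (w : 'rV[R]_2) :
  let x := w 0 0 in let y := w 0 1 in
  quadratic_field mu a b c p q r w = 0 <->
  mu * x + a * x ^+ 2 + b * x * y + c * y ^+ 2 = 0 /\
  mu * y + p * x ^+ 2 + q * x * y + r * y ^+ 2 = 0.
Proof.
move=> x y; split => [/rowP E|[E0 E1]].
  by split; [have := E 0 | have := E 1]; rewrite !mxE.
by apply/rowP => -[[|[|//]] i]; rewrite !mxE.
Qed.

(** With [t = - mu / lam], the eigenvalues are [- mu] and [- (t * D)]. Their product is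
    [- (t ^+ 2 * (lam * D))], so its sign is opposite to that of [lam * D]. *)
Lemma direction_point_type (R : realType) (mu a b c p q r : R) (d : R * R * R)
    (f := quadratic_field mu a b c p q r) (w := direction_point mu d)
    (D := transversal_slope a b q r d) :
  mu != 0 -> eigendirection a b c p q r d ->
  [/\ nonzero_fixed_points f w, `[< node f w >] = (d.2 * D < 0)
    & `[< saddle_point f w >] = (0 < d.2 * D)].
Proof.
rewrite {}/D {}/w; case: d => [[u v] lam] /= mu0 /and4P[uv0 lam0 /eqP EA /eqP EB].
set w := \row_j _; set D := 3 * lam - _.
have [t tE] : exists t, t = - mu / lam by exists (- mu / lam).
(* Eliminating [mu] in favour of [t] makes the identities below polynomial. *)
have muE : mu = - (t * lam) by rewrite tE divfK ?opprK.
have t0 : t != 0 by move: mu0; rewrite muE oppr_eq0 mulf_eq0 negb_or => /andP[].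
have w0 : w 0 0 = t * u by rewrite mxE /= -tE.
have w1 : w 0 1 = t * v by rewrite mxE /= -tE.
have fw : f w = 0.
  apply/quadratic_field_eq0; rewrite w0 w1; split.
    have -> : mu * (t * u) + a * (t * u) ^+ 2 + b * (t * u) * (t * v)
      + c * (t * v) ^+ 2 = mu * t * u + t ^+ 2 * (a * u ^+ 2 + b * u * v + c * v ^+ 2) by ring.
    rewrite EA muE; ring.
  have -> : mu * (t * v) + p * (t * u) ^+ 2 + q * (t * u) * (t * v)
    + r * (t * v) ^+ 2 = mu * t * v + t ^+ 2 * (p * u ^+ 2 + q * u * v + r * v ^+ 2) by ring.
  rewrite EB muE; ring.
have ev : eigenvalue_pair ('J f w) (- mu) (- (t * D)).
  have [J00 J01 J10 J11] := jacobian_quadratic_field mu a b c p q r w.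
  apply: char_poly_mx22; rewrite J00 ?J01 ?J10 J11 w0 w1 muE.
    rewrite /D; ring.
  (* (u, v) is an eigenvector for 2 lam of the derivative of the quadratic
     part, which gives its determinant. *)
  set det := (2 * a * u + b * v) * (q * u + 2 * r * v)
             - (2 * p * u + q * v) * (b * u + 2 * c * v).
  have detE : det = 2 * lam * (lam - D).
    suff [Hu Hv] : u * (det - 2 * lam * (lam - D)) = 0
                /\ v * (det - 2 * lam * (lam - D)) = 0.
      apply/eqP; rewrite -subr_eq0; case/orP: uv0 => h0.
        by rewrite -(mulrI_eq0 _ (mulfI h0)) Hu.
      by rewrite -(mulrI_eq0 _ (mulfI h0)) Hv.
    pose eA := a * u ^+ 2 + b * u * v + c * v ^+ 2 - lam * u.
    pose eB := p * u ^+ 2 + q * u * v + r * v ^+ 2 - lam * v.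
    have eA0 : eA = 0 by rewrite /eA EA subrr.
    have eB0 : eB = 0 by rewrite /eB EB subrr.
    split.
      (* For the derivative [M] of the quadratic part, [(M - 2 * lam) (u, v)] is [2 * (eA, eB)] by
         Euler's identity. Multiplying by the adjugate of [M - 2 * lam] gives its determinant times
         [(u, v)]; the coefficients here are the first row of that adjugate. *)
      transitivity (2 * ((q * u + 2 * r * v - 2 * lam) * eA
                         - (b * u + 2 * c * v) * eB)).
        rewrite /eA /eB /det /D; ring.
      by rewrite eA0 eB0 !mulr0 subrr mulr0.
    transitivity (2 * ((2 * a * u + b * v - 2 * lam) * eB
                       - (2 * p * u + q * v) * eA)).
      rewrite /eA /eB /det /D; ring.
    by rewrite eA0 eB0 !mulr0 subrr mulr0.
  transitivity (t ^+ 2 * (lam ^+ 2 - lam * (3 * lam - D) + det)).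
    rewrite /det /D; ring.
  rewrite detE; ring.
have lE : - mu * - (t * D) = - (t ^+ 2 * (lam * D)) by rewrite muE; ring.
have t2 : 0 < t ^+ 2 by rewrite exprn_even_gt0.
split.
- split => //; apply/eqP => /rowP E; move: (E 0) (E 1); rewrite w0 w1 !mxE.
  by move=> /eqP; rewrite mulf_eq0 (negPf t0) => /eqP u0 /eqP;
    rewrite mulf_eq0 (negPf t0) => /eqP v0; rewrite u0 v0 eqxx in uv0.
- by rewrite (nodeE fw ev) lE oppr_gt0 pmulr_rlt0.
- by rewrite (saddle_pointE fw ev) lE oppr_lt0 pmulr_rgt0.
Qed.

(** On the line the point is [t * (u, v)], and the equations become [t * (mu + t * lam) = 0], which
    has a single non-zero solution. *)
Lemma direction_pointP (R : realType) (mu a b c p q r : R) (d : R * R * R)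
    (w : 'rV[R]_2) :
  eigendirection a b c p q r d ->
  nonzero_fixed_points (quadratic_field mu a b c p q r) w ->
  w 0 0 * d.1.2 = w 0 1 * d.1.1 -> w = direction_point mu d.
Proof.
case: d => [[u v] lam] /= /and4P[uv0 lam0 /eqP EA /eqP EB] [w0 /quadratic_field_eq0[]].
move=> fA fB par.
have [t [tu tv]] : exists t, w 0 0 = t * u /\ w 0 1 = t * v.
  case/orP: uv0 => h0.
    by exists (w 0 0 / u); rewrite divfK // mulrAC par mulfK.
  by exists (w 0 1 / v); rewrite divfK // mulrAC -par mulfK.
have t0 : t != 0.
  apply: contra_neq w0 => t0; apply/rowP => -[[|[|//]] i]; rewrite mxE.
    by rewrite (_ : Ordinal i = 0) ?tu ?t0 ?mul0r //; exact/val_inj.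
  by rewrite (_ : Ordinal i = 1) ?tv ?t0 ?mul0r //; exact/val_inj.
have {fA} fA : t * u * (mu + t * lam) = 0.
  rewrite -fA tu tv mulrDr.
  have -> : t * u * (t * lam) = t ^+ 2 * (lam * u) by ring.
  rewrite -EA; ring.
have {fB} fB : t * v * (mu + t * lam) = 0.
  rewrite -fB tu tv mulrDr.
  have -> : t * v * (t * lam) = t ^+ 2 * (lam * v) by ring.
  rewrite -EB; ring.
have muE : mu + t * lam = 0.
  case/orP: uv0 => h0.
    by move/eqP: fA; rewrite !mulf_eq0 (negPf h0) (negPf t0) => /eqP.
  by move/eqP: fB; rewrite !mulf_eq0 (negPf h0) (negPf t0) => /eqP.
have tE : t = - mu / lam.
  by apply: (mulIf lam0); rewrite divfK //; lra.
apply/rowP => -[[|[|//]] i]; rewrite mxE /= -tE.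
  by rewrite (_ : Ordinal i = 0) //; exact/val_inj.
by rewrite (_ : Ordinal i = 1) //; exact/val_inj.
Qed.

(** Reduces the count to a list of pairwise non-proportional eigendirections that exhausts the real
    lines on which [y A - x B] vanishes. *)
Lemma fixed_point_count_directions (R : realType) (mu a b c p q r : R)
    (s : seq (R * R * R)) (D := transversal_slope a b q r) :
  mu != 0 -> all (eigendirection a b c p q r) s ->
  pairwise (fun d e => d.1.1 * e.1.2 != d.1.2 * e.1.1) s ->
  (forall x y, y * (a * x ^+ 2 + b * x * y + c * y ^+ 2)
               = x * (p * x ^+ 2 + q * x * y + r * y ^+ 2) ->
    has (fun d => x * d.1.2 == y * d.1.1) s) ->
  fixed_point_count (quadratic_field mu a b c p q r) (size s)
    (count (fun d => d.2 * D d < 0) s) (count (fun d => 0 < d.2 * D d) s).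
Proof.
move=> mu0 aes ps cs; have es := allP aes.
have type d ds := direction_point_type mu0 (es d ds).
have us : uniq [seq direction_point mu d | d <- s].
  rewrite uniq_pairwise pairwise_map.
  apply: sub_in_pairwise aes ps.
  move=> [[u v] l] [[u' v'] l'] /and4P[uv0 l0 _ _] /and4P[uv0' l0' _ _] /=.
  apply: contra_neq => /rowP E; move: (E 0) (E 1); rewrite !mxE /=.
  move=> Eu Ev; have k0 : - mu / l != 0 by rewrite mulf_neq0 ?oppr_eq0 ?invr_eq0.
  have k0' : - mu / l' != 0 by rewrite mulf_neq0 ?oppr_eq0 ?invr_eq0.
  apply: (mulfI k0); apply: (mulfI k0'); rewrite mulrA.
  transitivity ((- mu / l * u) * (- mu / l' * v')); first ring.
  rewrite Eu -Ev; ring.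
have fs : nonzero_fixed_points (quadratic_field mu a b c p q r) =
    [set` [seq direction_point mu d | d <- s]].
  apply/seteqP; split => w /=.
    move=> fw; have [_ /quadratic_field_eq0[fA fB]] := fw.
    have /hasP[d ds /eqP par] : has (fun d => w 0 0 * d.1.2 == w 0 1 * d.1.1) s.
      apply: cs; apply/eqP; rewrite -subr_eq0; apply/eqP.
      (* Taking [y] times the first equation minus [x] times the second cancels the terms in
         [mu]. *)
      transitivity (w 0 1 * 0 - w 0 0 * 0 : R); last by rewrite !mulr0 subrr.
      rewrite -{1}fA -fB; ring.
    by apply/mapP; exists d => //; apply: direction_pointP fw par; exact: es.
  by case/mapP => d /type[fw _ _] ->.
have := fixed_point_count_seq us fs; rewrite size_map !count_map.
have nodes : {in s, preim (direction_point mu)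
    (fun v => `[< node (quadratic_field mu a b c p q r) v >])
    =1 (fun d => d.2 * D d < 0)} by move=> d /type[].
have saddles : {in s, preim (direction_point mu)
    (fun v => `[< saddle_point (quadratic_field mu a b c p q r) v >])
    =1 (fun d => 0 < d.2 * D d)} by move=> d /type[].
by rewrite (eq_in_count nodes) (eq_in_count saddles).
Qed.

(** * Real binary forms: linear factors and definiteness *)

(** The equations express [e0 x^3 + e1 x^2 y + e2 x y^2 + e3 y^3] as
    [(v x - u y) (k0 x^2 + k1 x y + k2 y^2)]. If [e0 = 0] then [y] is a factor; otherwise a cubic
    has a real root [s], and the quotient comes from Horner division. *)
Lemma cubic_form_factor (R : rcfType) (e0 e1 e2 e3 : R) :
  exists u v k0 k1 k2 : R, [/\ (u != 0) || (v != 0), e0 = v * k0,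
    e1 = v * k1 - u * k0, e2 = v * k2 - u * k1 & e3 = - (u * k2)].
Proof.
have [->|e00] := eqVneq e0 0.
  by exists 1, 0, (- e1), (- e2), (- e3); rewrite oner_neq0; split => //; ring.
have [s] : {s | root (Poly [:: e3; e2; e1; e0]) s}.
  by apply: polyrcf.odd_poly_root; rewrite (@PolyK _ 1).
rewrite /root horner_Poly /= => /eqP s0.
exists s, 1, e0, (e1 + s * e0), (e2 + s * (e1 + s * e0)).
rewrite oner_neq0 orbT; split => //; try ring.
apply/eqP; rewrite -subr_eq0; apply/eqP; rewrite -[RHS]s0; ring.
Qed.

(** The factors are [v x - u y] and [v' x - u' y], found by the quadratic formula unless [k0 = 0],
    when [y] is a factor. *)
Lemma quadratic_form_factor (R : rcfType) (k0 k1 k2 : R) :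
  0 < k1 ^+ 2 - 4 * k0 * k2 ->
  exists u v u' v' : R,
    [/\ k0 = v * v', k1 = - (v * u' + u * v') & k2 = u * u'].
Proof.
set disc := (X in 0 < X) => disc0.
have [k00|k00] := eqVneq k0 0.
  by exists (-1), 0, (- k2), k1; rewrite k00; split; ring.
have dE : Num.sqrt disc ^+ 2 = disc by rewrite sqr_sqrtr // ltW.
set e := Num.sqrt disc in dE.
exists ((- k1 + e) / 2), k0, ((- k1 - e) / (2 * k0)), 1; split; first ring.
  by field.
have -> : (- k1 + e) / 2 * ((- k1 - e) / (2 * k0)) = (k1 ^+ 2 - e ^+ 2) / (4 * k0).
  by field.
by rewrite dE /disc; field.
Qed.

(** Completing the square; [k0] cannot vanish, as the discriminant would then be a square. *)
Lemma definite_form_gt0 (R : realFieldType) (k0 k1 k2 x y : R) :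
  k1 ^+ 2 - 4 * k0 * k2 < 0 -> (x != 0) || (y != 0) ->
  0 < k0 * (k0 * x ^+ 2 + k1 * x * y + k2 * y ^+ 2).
Proof.
move=> disc0 xy0; rewrite -(pmulr_rgt0 _ (ltr0n _ 4)).
have -> : 4%:R * (k0 * (k0 * x ^+ 2 + k1 * x * y + k2 * y ^+ 2))
  = (2 * k0 * x + k1 * y) ^+ 2 - (k1 ^+ 2 - 4 * k0 * k2) * y ^+ 2 by ring.
have [y0|y0] := eqVneq y 0.
  rewrite y0 eqxx orbF in xy0; rewrite y0 mulr0 addr0 expr0n mulr0 subr0.
  rewrite exprn_even_gt0 //= !mulf_neq0 ?pnatr_eq0 //.
  by apply: contraTneq disc0 => ->; rewrite mulr0 mul0r subr0 -leNgt sqr_ge0.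
by rewrite ltr_wpDl ?sqr_ge0 // oppr_gt0 nmulr_rlt0 // exprn_even_gt0.
Qed.

(** * Sign patterns of three numbers with sum 1 *)

(** One or three of the numbers are negative, and three would make the sum negative. The sums of
    booleans have the shape to which [count] unfolds. *)
Lemma count_signs_mul_lt0 (R : realFieldType) (s1 s2 s3 : R) :
  s1 + s2 + s3 = 1 -> s1 * s2 * s3 < 0 ->
  ((s1 < 0)%R + ((s2 < 0)%R + ((s3 < 0)%R + 0)) = 1 /\
   (0 < s1)%R + ((0 < s2)%R + ((0 < s3)%R + 0)) = 2)%N.
Proof.
move=> sum prod.
have [h1|h1|h1] := ltgtP s1 0; have [h2|h2|h2] := ltgtP s2 0;
  have [t|t|t] := ltgtP (s1 * s2) 0;
  have [h3|h3|h3] := ltgtP s3 0 => //; exfalso; try nra.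
Qed.

(** Each number is negative or exceeds 1. None or two are negative, and with none the sum would
    exceed 3. *)
Lemma count_signs_mul_gt0 (R : realFieldType) (s1 s2 s3 : R) :
  s1 + s2 + s3 = 1 -> 0 < s1 * s2 * s3 ->
  0 < s1 * (s1 - 1) -> 0 < s2 * (s2 - 1) -> 0 < s3 * (s3 - 1) ->
  ((s1 < 0)%R + ((s2 < 0)%R + ((s3 < 0)%R + 0)) = 2 /\
   (0 < s1)%R + ((0 < s2)%R + ((0 < s3)%R + 0)) = 1)%N.
Proof.
move=> sum prod.
have [h1|h1|h1] := ltgtP s1 0; have [h2|h2|h2] := ltgtP s2 0;
  have [t|t|t] := ltgtP (s1 * s2) 0;
  have [h3|h3|h3] := ltgtP s3 0 => // g1 g2 g3; exfalso; try nra.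
Qed.

(** * Fixed points according to the sign of [P] *)

(* With (A, B) the quadratic part, y A - x B = (v x - u y) K(x, y) and
   (A, B) = (m1 x + m2 y) (x, y) - K(x, y) (u, v), where
   K(x, y) = k0 x^2 + k1 x y + k2 y^2. *)
Lemma quadratic_part_factor (R : rcfType) (a b c p q r : R) :
  exists u v k0 k1 k2 m1 m2 : R, (u != 0) || (v != 0) /\
    [/\ a = m1 - u * k0, b = m2 - u * k1 & c = - (u * k2)] /\
    [/\ p = - (v * k0), q = m1 - v * k1 & r = m2 - v * k2].
Proof.
have [u [v [k0 [k1 [k2 [uv0 E0 E1 E2 E3]]]]]] :=
  cubic_form_factor (- p) (a - q) (b - r) c.
exists u, v, k0, k1, k2, (a + u * k0), (b + u * k1); split => //.
by split; split => //; lra.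
Qed.

(** Here [K] has negative discriminant, so it is definite and [(u, v)] spans the only line. As
    [R = - lam * K m2 (- m1)] and the transversal slope is [- K u v], the sign of [R] is that of
    [lam] times the slope. *)
Lemma fixed_point_count_P_gt0 (R : realType) (mu a b c p q r : R) :
  mu != 0 -> 0 < P_of a b c p q r -> R_of a b c p q r != 0 ->
  fixed_point_count (quadratic_field mu a b c p q r) 1
    (R_of a b c p q r < 0)%R (0 < R_of a b c p q r)%R.
Proof.
move=> mu0; have [u [v [k0 [k1 [k2 [m1 [m2 [uv0 [[-> -> ->] [-> -> ->]]]]]]]]]] :=
  quadratic_part_factor a b c p q r.
pose K x y := k0 * x ^+ 2 + k1 * x * y + k2 * y ^+ 2.
pose lam := m1 * u + m2 * v - K u v.
set Rv := R_of _ _ _ _ _ _.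
have -> : P_of (m1 - u * k0) (m2 - u * k1) (- (u * k2)) (- (v * k0))
    (m1 - v * k1) (m2 - v * k2) = - (k1 ^+ 2 - 4 * k0 * k2) * K u v ^+ 2.
  rewrite /P_of /K; ring.
have RE : Rv = - (lam * K m2 (- m1)) by rewrite /Rv /R_of /lam /K; ring.
move=> P0 R0.
have disc0 : k1 ^+ 2 - 4 * k0 * k2 < 0.
  by rewrite -oppr_gt0; move: P0 (sqr_ge0 (K u v)); set t := _ ^+ 2; nra.
have K1 := definite_form_gt0 disc0 uv0; rewrite -/(K u v) in K1.
have lam0 : lam != 0 by apply: contra_neq R0 => l0; rewrite RE l0 mul0r oppr0.
have m0 : (m2 != 0) || (- m1 != 0).
  apply: contraNT R0; rewrite negb_or !negbK => /andP[/eqP n2 /eqP n1].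
  by rewrite RE /K n2 n1 !(expr0n, mulr0, addr0, mul0r, oppr0).
have K2 := definite_form_gt0 disc0 m0; rewrite -/(K m2 (- m1)) in K2.
set f := quadratic_field _ _ _ _ _ _ _.
have := @fixed_point_count_directions R mu (m1 - u * k0) (m2 - u * k1)
  (- (u * k2)) (- (v * k0)) (m1 - v * k1) (m2 - v * k2) [:: (u, v, lam)] mu0.
rewrite -/f /= !addn0.
have -> : 3 * lam - ((2 * (m1 - u * k0) + (m1 - v * k1)) * u
    + (m2 - u * k1 + 2 * (m2 - v * k2)) * v) = - K u v.
  rewrite /lam /K; ring.
have sgn : 0 < Rv * (lam * - K u v).
  rewrite RE; have -> : - (lam * K m2 (- m1)) * (lam * - K u v) =
    lam ^+ 2 * (K u v * K m2 (- m1)) by ring.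
  rewrite mulr_gt0 ?exprn_even_gt0 //.
  by move: (mulr_gt0 K1 K2); set s := K u v; set t := K m2 _ => ?; nra.
have -> : (lam * - K u v < 0) = (Rv < 0).
  have [h|h|h] := ltgtP Rv 0; have [g|g|g] := ltgtP (lam * - K u v) 0 => //; nra.
have -> : (0 < lam * - K u v) = (0 < Rv).
  have [h|h|h] := ltgtP Rv 0; have [g|g|g] := ltgtP (lam * - K u v) 0 => //; nra.
apply => //.
- rewrite andbT /eigendirection uv0 lam0 /=; apply/andP; split; apply/eqP;
    rewrite /lam /K; ring.
(* The cubic is [(x * v - y * u) * K x y], and a definite [K] vanishes only at the origin. *)
- move=> x y E; rewrite orbF -subr_eq0.
  have : (x * v - y * u) * K x y = 0.
    apply/eqP; move/eqP: E; rewrite -subr_eq0; congr (_ == _); rewrite /K; ring.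
  move=> /eqP; rewrite mulf_eq0 => /orP[//|/eqP Kxy].
  have [xy0|] := boolP ((x != 0) || (y != 0)).
    by have := definite_form_gt0 disc0 xy0; rewrite -/(K x y) Kxy mulr0 ltxx.
  by rewrite negb_or !negbK => /andP[/eqP -> /eqP ->]; rewrite !mul0r subrr.
Qed.

(** Now [K] splits, giving three lines; [P] is minus the square of [w12 * w13 * w23], so they are
    distinct. Each [s] is the ratio [l / D] of eigenvalue to transversal slope. *)
Lemma fixed_point_count_P_lt0 (R : realType) (mu a b c p q r : R) :
  mu != 0 -> P_of a b c p q r < 0 -> R_of a b c p q r != 0 ->
  exists s1 s2 s3 : R, [/\ s1 + s2 + s3 = 1,
    0 < - R_of a b c p q r * (s1 * s2 * s3),
    forall s, s \in [:: s1; s2; s3] -> exists k x y,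
      [/\ k != 0, (x != 0) || (y != 0) &
      k ^+ 2 * (s * (s - 1)) = (a * q - b * p) * x ^+ 2
        + 2 * (a * r - p * c) * x * y + (b * r - c * q) * y ^+ 2] &
    fixed_point_count (quadratic_field mu a b c p q r) 3
      ((s1 < 0)%R + ((s2 < 0)%R + ((s3 < 0)%R + 0)))
      ((0 < s1)%R + ((0 < s2)%R + ((0 < s3)%R + 0)))].
Proof.
move=> mu0; have [u [v [k0 [k1 [k2 [m1 [m2 [uv0 [[-> -> ->] [-> -> ->]]]]]]]]]] :=
  quadratic_part_factor a b c p q r.
set f := quadratic_field _ _ _ _ _ _ _.
set Rv := R_of _ _ _ _ _ _.
have PE : P_of (m1 - u * k0) (m2 - u * k1) (- (u * k2)) (- (v * k0))
    (m1 - v * k1) (m2 - v * k2) = - (k1 ^+ 2 - 4 * k0 * k2)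
      * (k0 * u ^+ 2 + k1 * u * v + k2 * v ^+ 2) ^+ 2.
  rewrite /P_of; ring.
rewrite PE => P0 R0.
have disc0 : 0 < k1 ^+ 2 - 4 * k0 * k2.
  by move: P0 (sqr_ge0 (k0 * u ^+ 2 + k1 * u * v + k2 * v ^+ 2));
    set t := (k0 * _ + _ + _) ^+ 2; nra.
have [u2 [v2 [u3 [v3 [E0 E1 E2]]]]] := quadratic_form_factor disc0.
subst k0 k1 k2; clear disc0 PE.
pose w12 := u * v2 - v * u2; pose w13 := u * v3 - v * u3.
pose w23 := u2 * v3 - v2 * u3.
have : w12 * w13 * w23 != 0.
  apply: contraTneq P0 => w0; rewrite -leNgt.
  rewrite (_ : - _ * _ = - (w12 * w13 * w23) ^+ 2); last by rewrite /w12 /w13 /w23; ring.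
  by rewrite w0 expr0n oppr0.
rewrite !mulf_eq0 !negb_or => /andP[/andP[n12 n13] n23].
have n2 : (u2 != 0) || (v2 != 0).
  apply: contraNT n12; rewrite negb_or !negbK => /andP[/eqP h1 /eqP h2].
  by rewrite /w12 h1 h2 !mulr0 subrr.
have n3 : (u3 != 0) || (v3 != 0).
  apply: contraNT n13; rewrite negb_or !negbK => /andP[/eqP h1 /eqP h2].
  by rewrite /w13 h1 h2 !mulr0 subrr.
(* The value of [K] is [w12 * w13] at [(u, v)] and zero at the other two directions. *)
pose l1 := m1 * u + m2 * v - w12 * w13.
pose l2 := m1 * u2 + m2 * v2; pose l3 := m1 * u3 + m2 * v3.
have RE : Rv = - (l1 * l2 * l3) by rewrite /Rv /R_of /l1 /l2 /l3 /w12 /w13; ring.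
have : l1 * l2 * l3 != 0 by rewrite -oppr_eq0 -RE.
rewrite !mulf_eq0 !negb_or => /andP[/andP[l10 l20] l30].
pose D1 := - (w12 * w13); pose D2 := w12 * w23; pose D3 := - (w13 * w23).
have D10 : D1 != 0 by rewrite oppr_eq0 mulf_neq0.
have D20 : D2 != 0 by rewrite mulf_neq0.
have D30 : D3 != 0 by rewrite oppr_eq0 mulf_neq0.
have form (l D x y : R) (H : R -> R -> R) : D != 0 -> (x != 0) || (y != 0) ->
    l * (l - D) = H x y -> exists k x y, [/\ k != 0, (x != 0) || (y != 0)
      & k ^+ 2 * (l / D * (l / D - 1)) = H x y].
  by move=> D0 xy0 E; exists D, x, y; split => //; rewrite -E; field.
have sgn_lt (l D : R) : D != 0 -> (l * D < 0) = (l / D < 0).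
  move=> D0; have D2p : 0 < D ^+ 2 by rewrite exprn_even_gt0.
  by rewrite -(pmulr_rlt0 (l / D) D2p); congr (_ < 0); field.
have sgn_gt (l D : R) : D != 0 -> (0 < l * D) = (0 < l / D).
  move=> D0; have D2p : 0 < D ^+ 2 by rewrite exprn_even_gt0.
  by rewrite -(pmulr_rgt0 (l / D) D2p); congr (0 < _); field.
exists (l1 / D1), (l2 / D2), (l3 / D3); split.
(* Only the term [- (w12 * w13)] of [l1] contributes to the sum: the parts linear in [m1], [m2]
   cancel by the relation [w23 X1 - w13 X2 + w12 X3 = 0] between three plane vectors. *)
- rewrite /l1 /l2 /l3 /D1 /D2 /D3; move: n12 n13 n23; rewrite /w12 /w13 /w23 => *.
  by field; apply/and3P.
- rewrite RE.
  have -> : - - (l1 * l2 * l3) * (l1 / D1 * (l2 / D2) * (l3 / D3)) =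
      (l1 * l2 * l3 / (w12 * w13 * w23)) ^+ 2.
    by rewrite /D1 /D2 /D3; field; apply/and3P.
  by rewrite exprn_even_gt0 // mulf_neq0 ?invr_eq0 ?mulf_neq0.
- move=> s; rewrite !inE => /or3P[] /eqP ->.
  + apply: (form _ _ u v (fun x y => _)) => //; rewrite /l1 /D1 /w12 /w13; ring.
  + apply: (form _ _ u2 v2 (fun x y => _)) => //; rewrite /l2 /D2 /w12 /w23; ring.
  + apply: (form _ _ u3 v3 (fun x y => _)) => //; rewrite /l3 /D3 /w13 /w23; ring.
rewrite -!sgn_lt // -!sgn_gt //.
have := @fixed_point_count_directions R mu (m1 - u * (v2 * v3))
  (m2 - u * - (v2 * u3 + u2 * v3)) (- (u * (u2 * u3))) (- (v * (v2 * v3)))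
  (m1 - v * - (v2 * u3 + u2 * v3)) (m2 - v * (u2 * u3))
  [:: (u, v, l1); (u2, v2, l2); (u3, v3, l3)] mu0.
rewrite -/f /=.
set d1 := 3 * l1 - _; set d2 := 3 * l2 - _; set d3 := 3 * l3 - _.
have -> : d1 = D1 by rewrite /d1 /D1 /l1 /w12 /w13; ring.
have -> : d2 = D2 by rewrite /d2 /D2 /l2 /w12 /w23; ring.
have -> : d3 = D3 by rewrite /d3 /D3 /l3 /w13 /w23; ring.
apply.
- rewrite uv0 l10 n2 l20 n3 l30 /= andbT.
  do ![apply/andP; split]; apply/eqP; rewrite /l1 /l2 /l3 /w12 /w13; ring.
- by move: n12 n13 n23; rewrite /w12 /w13 /w23 !subr_eq0 => -> -> ->.
- move=> x y E; rewrite orbF -!(subr_eq0 (x * _)) -!mulf_eq0.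
  move/eqP: E; rewrite -subr_eq0; congr (_ == _); ring.
Qed.

(** * The five cases *)

Unset Implicit Arguments.

Theorem mainTheorem1 (R : realType) (a b c p q r mu : R) (hmu : mu != 0) :
  let f := quadratic_field mu a b c p q r in
  let P0 := P_of a b c p q r in
  let R0 := R_of a b c p q r in
  let I0 := I_of a b c p q r in
  (0 < P0 -> 0 < R0 -> fixed_point_count f 1 0 1) /\
  (0 < P0 -> R0 < 0 -> fixed_point_count f 1 1 0) /\
  (P0 < 0 -> 0 < R0 -> fixed_point_count f 3 1 2) /\
  (P0 < 0 -> R0 < 0 -> 0 < I0 -> fixed_point_count f 3 2 1) /\
  (P0 < 0 -> R0 < 0 -> I0 < 0 -> fixed_point_count f 3 0 3).
Proof.
move=> f P0 R0 I0.
(* The quadratic form on the right has discriminant [4 * R0] and trace [I0]. *)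
have definite k x y s : R0 < 0 -> k != 0 -> (x != 0) || (y != 0) ->
    k ^+ 2 * (s * (s - 1)) = (a * q - b * p) * x ^+ 2
      + 2 * (a * r - p * c) * x * y + (b * r - c * q) * y ^+ 2 ->
    0 < I0 * (s * (s - 1)).
  move=> R0n k0 xy0 E.
  have disc0 : (2 * (a * r - p * c)) ^+ 2
      - 4 * (a * q - b * p) * (b * r - c * q) < 0.
    by move: R0n; rewrite /R0 /R_of => R0n; lra.
  have k2 : 0 < k ^+ 2 by rewrite exprn_even_gt0.
  have := definite_form_gt0 disc0 xy0; rewrite -E mulrCA pmulr_rgt0 // => pos.
  (* The product of the diagonal coefficients exceeds [(a * r - p * c) ^+ 2], so they share a sign,
     which is also that of their sum [I0]. *)
  have /(mulr_gt0 pos) : 0 < (a * q - b * p) * I0.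
    move: R0n; have -> : I0 = (a * q - b * p) + (b * r - c * q).
      rewrite /I0 /I_of; ring.
    rewrite (_ : R0 = (a * r - p * c) ^+ 2 - (a * q - b * p) * (b * r - c * q));
      last by rewrite /R0 /R_of; ring.
    move: (sqr_ge0 (a * r - p * c)) (sqr_ge0 (a * q - b * p)).
    by lra.
  have -> : (a * q - b * p) * (s * (s - 1)) * ((a * q - b * p) * I0)
    = (a * q - b * p) ^+ 2 * (I0 * (s * (s - 1))) by ring.
  rewrite pmulr_rgt0 // exprn_even_gt0 //=.
  by apply: contraTneq pos => ->; rewrite mul0r ltxx.
split; [|split; [|split; [|split]]].
- move=> P0p R0p; have := fixed_point_count_P_gt0 hmu P0p (lt0r_neq0 R0p).
  by rewrite -/R0 R0p ltNge (ltW R0p).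
- move=> P0p R0n; have := fixed_point_count_P_gt0 hmu P0p (ltr0_neq0 R0n).
  by rewrite -/R0 R0n ltNge (ltW R0n).
- move=> P0n R0p.
  have [s1 [s2 [s3 [sum prod _]]]] := fixed_point_count_P_lt0 hmu P0n (lt0r_neq0 R0p).
  rewrite -/R0 nmulr_rgt0 ?oppr_lt0 // in prod.
  by have [-> ->] := count_signs_mul_lt0 sum prod.
- move=> P0n R0n I0p.
  have [s1 [s2 [s3 [sum prod form]]]] :=
    fixed_point_count_P_lt0 hmu P0n (ltr0_neq0 R0n).
  rewrite -/R0 pmulr_rgt0 ?oppr_gt0 // in prod.
  have g s : s \in [:: s1; s2; s3] -> 0 < s * (s - 1).
    move=> /form[k [x [y [k0 xy0 E]]]].
    by have := definite _ _ _ _ R0n k0 xy0 E; rewrite pmulr_rgt0.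
  by have [|||-> ->] := count_signs_mul_gt0 sum prod;
    first [apply: g; rewrite !inE eqxx ?orbT | idtac].
- move=> P0n R0n I0n.
  have [s1 [s2 [s3 [sum prod form]]]] :=
    fixed_point_count_P_lt0 hmu P0n (ltr0_neq0 R0n).
  (* Since [I0 < 0], the product [s * (s - 1)] is negative, so [s] lies between 0 and 1. *)
  have g s : s \in [:: s1; s2; s3] -> 0 < s.
    move=> /form[k [x [y [k0 xy0 E]]]].
    have := definite _ _ _ _ R0n k0 xy0 E; rewrite nmulr_rgt0 // => ?; nra.
  have p1 : 0 < s1 by apply: g; rewrite !inE eqxx.
  have p2 : 0 < s2 by apply: g; rewrite !inE eqxx orbT.
  have p3 : 0 < s3 by apply: g; rewrite !inE eqxx !orbT.
  by rewrite p1 p2 p3 !ltNge !ltW.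
Qed.
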